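(* Let $1 < p < \infty$. Then $J_n$ is the unique Chebyshev center of $\Omega_n$ relative to the metric space $(M_n(\mathbb{R}), \|\cdot\|_{\mathcal{S}_p})$ (i.e. the unique $A\in M_n(\mathbb{R})$ minimizing $\sup_{B\in\Omega_n}\|A-B\|_{\mathcal{S}_p}$), and the corresponding Chebyshev radius is $$ \inf_{A\in M_n(\mathbb{R})}\sup_{B\in\Omega_n}\|A-B\|_{\mathcal{S}_p} = (n-1)^{1/p}. $$
   Context: $\Omega_n$ denotes the set of $n\times n$ doubly stochastic matrices (nonnegative real entries, all row and column sums equal to $1$). $J_n$ is the $n\times n$ matrix with all entries equal to $1/n$. For $p\ge1$, $\|A\|_{\mathcal{S}_p} := \big(\sum_{i=1}^n\sigma_i(A)^p\big)^{1/p}$ where $\sigma_i(A)$ are the singular values of $A$. Given a constraint set $\mathcal{R}\subseteq M_n(\mathbb{R})$ and a norm, the Chebyshev radius of $\Omega_n$ is $\inf_{A\in\mathcal{R}}\sup_{B\in\Omega_n}\|A-B\|$ and a Chebyshev center is any $A\in\mathcal{R}$ attaining this infimum; ''relative to the metric space $(M_n(\mathbb{R}),\|\cdot\|)$'' means $\mathcal{R}=M_n(\mathbb{R})$. *)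

(* Defs.v *)
From HB Require Import structures.
From mathcomp Require Import all_boot all_order all_algebra.
From mathcomp Require Import all_classical all_reals all_analysis.
Set Implicit Arguments. Unset Strict Implicit. Unset Printing Implicit Defensive.
Import Order.TTheory GRing.Theory Num.Theory.
Local Open Scope ring_scope.

Section Defs.
Variable R : realType.

Definition doubly_stochastic (n : nat) (B : 'M[R]_n) : Prop :=
  (forall i j, 0 <= B i j) /\
  (forall i, \sum_(j < n) B i j = 1) /\
  (forall j, \sum_(i < n) B i j = 1).

Definition Jmat (n : nat) : 'M[R]_n := \matrix_(i, j) (n%:R)^-1.

Definition is_singular_values (n : nat) (A : 'M[R]_n) (s : 'rV[R]_n) : Prop :=
  (forall i, 0 <= s 0 i) /\
  exists U V : 'M[R]_n,
    U *m U^T = 1%:M /\ V *m V^T = 1%:M /\ A = U *m diag_mx s *m V^T.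

(* the singular values of A (chosen; unique up to permutation) *)
Definition singular_values (n : nat) (A : 'M[R]_n) : 'rV[R]_n :=
  match pselect (exists s, is_singular_values A s) with
  | left h => projT1 (cid h)
  | right _ => 0
  end.

Definition schatten (n : nat) (p : R) (A : 'M[R]_n) : R :=
  (\sum_(i < n) (singular_values A 0 i) `^ p) `^ p^-1.

Definition cheb_sup (n : nat) (p : R) (A : 'M[R]_n) : \bar R :=
  ereal_sup [set (schatten p (A - B))%:E | B in [set B | doubly_stochastic B]].

Definition cheb_radius (n : nat) (p : R) : \bar R :=
  ereal_inf [set cheb_sup p A | A in [set: 'M[R]_n]].

End Defs.

(* Main.v *)
Require Import Defs.
From HB Require Import structures.
From mathcomp Require Import all_boot all_order all_algebra.
From mathcomp Require Import all_classical all_reals all_analysis.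
From mathcomp Require Import fingroup perm complex ring lra.
Set Implicit Arguments. Unset Strict Implicit. Unset Printing Implicit Defensive.
Import Order.TTheory GRing.Theory Num.Theory.
Local Open Scope ring_scope.

(* Write Pi = 1 - J, the orthogonal projection of rank n - 1.  If B is doubly
   stochastic, J - B = - B Pi is a contraction with a nontrivial kernel, so the
   sum of the p-th powers of its singular values is at most n - 1.  Conversely,
   for a permutation matrix P, the matrix J - P = - P Pi has n - 1 singular
   values equal to 1 and one equal to 0, and Hoelder's inequality (in the
   tangent form p s <= s^p + p - 1) gives
     p tr ((A - P)^T (J - P)) <= |A - P|_p^p + (p - 1) (n - 1).
   The left-hand side equals p (tr (A^T (J - P)) + n - 1), and since the cyclic
   shifts average to J, some cyclic shift P makes it at least p (n - 1).  Hence
   |A - P|_p^p >= n - 1, and strictness of the tangent inequality for p > 1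
   forces A - P = J - P in case of equality. *)

(** * Euclidean inner product of row vectors *)

Section RowNorm.
Variables (R : rcfType) (n : nat).
Implicit Types u v : 'rV[R]_n.

Lemma mulmx_trE u v : (u *m v^T) 0 0 = \sum_j u 0 j * v 0 j.
Proof. by rewrite mxE; apply: eq_bigr => j _; rewrite mxE. Qed.

Lemma mulmx_trC u v : u *m v^T = v *m u^T.
Proof.
apply/matrixP => i j; rewrite !ord1 !mulmx_trE.
by apply: eq_bigr => k _; rewrite mulrC.
Qed.

Lemma mulmx_tr_ge0 u : 0 <= (u *m u^T) 0 0.
Proof. by rewrite mulmx_trE; apply: sumr_ge0 => j _; rewrite -expr2 sqr_ge0. Qed.

Lemma mulmx_tr_eq0 u : ((u *m u^T) 0 0 == 0) = (u == 0).
Proof.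
apply/idP/eqP => [|->]; last by rewrite mul0mx mxE.
rewrite mulmx_trE psumr_eq0 => [/allP u0|j _]; last by rewrite -expr2 sqr_ge0.
apply/rowP => j; rewrite mxE; apply/eqP.
by have := u0 j (mem_index_enum j); rewrite mulf_eq0 orbb.
Qed.

Lemma mulmx_tr_gt0 u : (0 < (u *m u^T) 0 0) = (u != 0).
Proof. by rewrite lt_neqAle mulmx_tr_ge0 andbT eq_sym mulmx_tr_eq0. Qed.

Lemma mulmx_tr_scale c u :
  (c *: u) *m (c *: u)^T = (c ^+ 2 * (u *m u^T) 0 0)%:M.
Proof.
rewrite linearZ /= -scalemxAl -scalemxAr scalerA -expr2.
by rewrite {1}[u *m u^T]mx11_scalar scale_scalar_mx.
Qed.

Lemma exists_unit_multiple u : u != 0 ->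
  exists a, (a *: u) *m (a *: u)^T = 1%:M.
Proof.
rewrite -mulmx_tr_gt0 => u_gt0; exists (Num.sqrt ((u *m u^T) 0 0))^-1.
by rewrite mulmx_tr_scale exprVn sqr_sqrtr ?ltW// mulVf ?gt_eqF.
Qed.

End RowNorm.

(** * Existence of a singular value decomposition *)

Section SVD.
Variable R : rcfType.

(* A complex eigenvector x + iy of S for a + ib has
   b (x.x + y.y) = (xS).y - (yS).x = 0, so x and y are real eigenvectors. *)
Lemma symmetric_eigenvector n (S : 'M[R]_n.+1) : S^T = S ->
  exists (a : R) (u : 'rV_n.+1), u *m u^T = 1%:M /\ u *m S = a *: u.
Proof.
move=> symS; pose Sc := map_mx (real_complex R) S.
suff [a [u u0 uS]] : exists (a : R), exists2 u : 'rV_n.+1, u != 0 & u *m S = a *: u.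
  have [c cu] := exists_unit_multiple u0.
  by exists a, (c *: u); split=> //; rewrite -scalemxAl uS !scalerA mulrC.
have /closed_rootP[l] : size (char_poly Sc) != 1%N by rewrite size_char_poly.
rewrite -eigenvalue_root_char => /eigenvalueP[v vS v0].
pose x := map_mx (@complex.Re R) v; pose y := map_mx (@complex.Im R) v.
have vE : v = map_mx (real_complex R) x + 'i%C *: map_mx (real_complex R) y.
  by apply/rowP => j; rewrite !mxE [LHS]complexE.
case: l vS => a b; rewrite vE mulmxDl -scalemxAl -!map_mxM => vS.
have {vS} [xS yS] : x *m S = a *: x - b *: y /\ y *m S = b *: x + a *: y.
  move: (x *m S) (y *m S) vS; rewrite -/x -/y; move: x y {vE} => x y X Y vS.
  split; apply/rowP => j; have := congr1 (fun w : 'rV_n.+1 => w 0 j) vS;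
  rewrite !mxE /=; simpc; case=> h1 h2; [rewrite h1|rewrite h2]; ring.
have xy0 : b * ((x *m x^T) 0 0 + (y *m y^T) 0 0) = 0.
  have : (x *m S) *m y^T = (y *m S) *m x^T.
    by rewrite mulmx_trC trmx_mul symS mulmxA.
  rewrite xS yS !mulmxDl mulNmx -!scalemxAl [y *m x^T]mulmx_trC.
  move/(congr1 (fun w : 'M[R]_1 => w 0 0)); rewrite !mxE => h; lra.
have {v0}xyN0 : (x != 0) || (y != 0).
  apply: contraNT v0; rewrite negb_or !negbK vE => /andP[/eqP-> /eqP->].
  by rewrite !map_mx0 scaler0 addr0.
have b0 : b = 0.
  move/eqP: xy0; rewrite mulf_eq0 => /orP[/eqP//|].
  rewrite paddr_eq0 ?mulmx_tr_ge0// !mulmx_tr_eq0 => /andP[x0 y0].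
  by rewrite x0 y0 in xyN0.
move: xS yS; rewrite b0 !scale0r subr0 add0r => xS yS.
by case/orP: xyN0 => ?; exists a; [exists x|exists y].
Qed.

(** A unit eigenvector [u] of [A *m A^T] has eigenvalue [a = |uA|^2], so [v = uA / sqrt a] is a unit
    vector and [s = sqrt a] works whenever [uA] is nonzero. *)
Lemma exists_singular_pair n (A : 'M[R]_n.+1) :
  exists (s : R) (u v : 'rV_n.+1), [/\ 0 <= s, u *m u^T = 1%:M,
    v *m v^T = 1%:M, u *m A = s *: v & v *m A^T = s *: u].
Proof.
have [|a [u [u1 uA]]] := @symmetric_eigenvector n (A *m A^T).
  by rewrite trmx_mul trmxK.
(* If [uA = 0] then [A] is singular, and [v] is taken instead in the left kernel of [A^T], with
   [s = 0]. *)
have [uA0|uAN0] := eqVneq (u *m A) 0.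
  have : \det A^T == 0.
    rewrite det_tr; apply/det0P; exists u => //.
    apply: contra_eq_neq u1 => ->; rewrite mul0mx.
    by apply/eqP => /matrixP/(_ 0 0)/eqP; rewrite !mxE eq_sym oner_eq0.
  case/det0P => v v0 vA; have [c cv] := exists_unit_multiple v0.
  by exists 0, u, (c *: v); split=> //; rewrite ?scale0r// -scalemxAl vA scaler0.
have aE : ((u *m A) *m (u *m A)^T) 0 0 = a.
  by rewrite trmx_mul mulmxA -(mulmxA u) uA -scalemxAl u1 !mxE eqxx mulr1.
have a_gt0 : 0 < a by rewrite -aE mulmx_tr_gt0.
have s0 : Num.sqrt a != 0 by rewrite sqrtr_eq0 -ltNge.
exists (Num.sqrt a), u, ((Num.sqrt a)^-1 *: (u *m A)); split=> //.
- by rewrite mulmx_tr_scale aE exprVn sqr_sqrtr ?ltW// mulVf ?gt_eqF.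
- by rewrite scalerA divff// scale1r.
rewrite -scalemxAl -mulmxA uA scalerA; congr (_ *: _).
by rewrite -{2}(sqr_sqrtr (ltW a_gt0)) expr2 mulKf.
Qed.

(* The Householder reflection exchanging the first basis vector and u. *)
Lemma orthogonal_completion n (u : 'rV[R]_n.+1) : u *m u^T = 1%:M ->
  exists2 Q : 'M[R]_n.+1, Q *m Q^T = 1%:M & row 0 Q = u.
Proof.
move=> u1; pose e : 'rV[R]_n.+1 := delta_mx 0 0.
have [ue|ue] := eqVneq u e.
  by exists 1%:M; rewrite ?trmx1 ?mulmx1// row1 ue.
pose w := e - u; have w0 : w != 0 by rewrite subr_eq0 eq_sym.
have [c cw] := exists_unit_multiple w0.
have [x xE x1] : exists2 x, x = c *: w & x *m x^T = 1%:M by exists (c *: w).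
pose Q := 1%:M - 2 *: (x^T *m x).
have QT : Q^T = Q by rewrite linearB linearZ /= trmx_mul trmxK trmx1.
exists Q.
  have xx : x^T *m x *m (x^T *m x) = x^T *m x.
    by rewrite -mulmxA (mulmxA x) x1 mul1mx.
  rewrite QT /Q mulmxBl mul1mx mulmxBr mulmx1 -!scalemxAl -!scalemxAr xx.
  by move: (x^T *m x) => Y; apply/matrixP => i j; rewrite !mxE; ring.
(* As [e] and [u] are unit vectors, [|e - u|^2 = 2 (e - u).e], so the reflection subtracts exactly
   [w] from [e]. *)
have ew : 2 * (w *m e^T) 0 0 = (w *m w^T) 0 0.
  have ee : e *m e^T = 1%:M.
    rewrite trmx_delta mul_delta_mx; apply/matrixP => i j.
    by rewrite !mxE !ord1.
  rewrite /w [in RHS]linearB /= !mulmxBl !mulmxBr u1 ee [e *m u^T]mulmx_trC !mxE.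
  by rewrite eqxx; ring.
have wc : c ^+ 2 * (w *m w^T) 0 0 = 1.
  move: cw; rewrite mulmx_tr_scale.
  by move/(congr1 (fun w : 'M[R]_1 => w 0 0)); rewrite ![_%:M 0 0]mxE eqxx.
have ex : e *m x^T = (c * (w *m e^T) 0 0)%:M.
  by rewrite xE [LHS]mulmx_trC -scalemxAl {1}[w *m _]mx11_scalar scale_scalar_mx.
rewrite rowE -/e /Q mulmxBr mulmx1 -scalemxAr mulmxA ex mul_scalar_mx xE !scalerA.
have -> : 2 * (c * (w *m e^T) 0 0) * c = 1 :> R by rewrite -[RHS]wc -ew; ring.
by rewrite scale1r /w opprB addrC subrK.
Qed.

(** Induction on [n]: completing a singular pair to orthogonal [P] and [Q] makes the first row and
    column of [P A Q^T] vanish off the corner [s0]. The remaining block is decomposed by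
    induction. *)
Theorem exists_svd n (A : 'M[R]_n) :
  exists (s : 'rV[R]_n) (U V : 'M[R]_n), (forall i, 0 <= s 0 i) /\
    U *m U^T = 1%:M /\ V *m V^T = 1%:M /\ A = U *m diag_mx s *m V^T.
Proof.
elim: n A => [|n IHn] A.
  exists 0, 1%:M, 1%:M; split=> [i|].
    by rewrite mxE.
  by rewrite trmx1 mulmx1; split; last split; rewrite [LHS]flatmx0 [RHS]flatmx0.
have [s0 [u [v [s0_ge0 u1 v1 uA vA]]]] := exists_singular_pair A.
have [P PP Pu] := orthogonal_completion u1.
have [Q QQ Qv] := orthogonal_completion v1.
have PTP := mulmx1C PP; have QTQ := mulmx1C QQ.
pose M : 'M[R]_(1 + n) := P *m A *m Q^T.
pose M' := drsubmx M.
have [s [U [V [s_ge0 [UU [VV ME]]]]]] := IHn M'.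
have rowM : row 0 (P *m A *m Q^T) = s0 *: delta_mx 0 0.
  by rewrite !row_mul Pu uA -scalemxAl -Qv -row_mul QQ row1.
have rowMT : row 0 (P *m A *m Q^T)^T = s0 *: delta_mx 0 0.
  by rewrite !trmx_mul trmxK mulmxA !row_mul Qv vA -scalemxAl -Pu -row_mul PP row1.
have ord0E : lshift n 0 = 0 :> 'I_(1 + n) by apply: val_inj.
have MB : M = block_mx s0%:M 0 0 M'.
  rewrite -[LHS]submxK; congr block_mx; apply/matrixP => i j.
  - have := congr1 (fun w : 'rV_n.+1 => w 0 0) rowM; rewrite !mxE !ord1 !ord0E => ->.
    by rewrite !eqxx mulr1.
  - have := congr1 (fun w : 'rV_n.+1 => w 0 (rshift 1 j)) rowM.
    by rewrite !mxE !ord1 !ord0E => ->; rewrite mulr0.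
  - have := congr1 (fun w : 'rV_n.+1 => w 0 (rshift 1 i)) rowMT.
    by rewrite !mxE !ord1 !ord0E => ->; rewrite mulr0.
pose D (W : 'M[R]_n) : 'M[R]_(1 + n) := block_mx 1%:M 0 0 W.
have DO W : W *m W^T = 1%:M -> D W *m (D W)^T = 1%:M.
  move=> WW; rewrite tr_block_mx mulmx_block !trmx0 trmx1.
  by rewrite !(mulmx0, mul0mx, addr0, add0r, mulmx1) WW -scalar_mx_block.
exists (row_mx s0%:M s : 'rV_(1 + n)), (P^T *m D U), (Q^T *m D V); split=> [i|].
  rewrite mxE; case: splitP => j _ //.
  by rewrite !ord1 mxE eqxx.
split; first by rewrite trmx_mul mulmxA -(mulmxA P^T) DO// mulmx1 trmxK.
split; first by rewrite trmx_mul mulmxA -(mulmxA Q^T) DO// mulmx1 trmxK.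
rewrite trmx_mul trmxK !mulmxA -[_ *m diag_mx _]mulmxA -[_ *m _ *m (D V)^T]mulmxA.
have -> : D U *m diag_mx (row_mx s0%:M s : 'rV_(1 + n)) *m (D V)^T = M.
  rewrite diag_mx_row tr_block_mx !mulmx_block MB ME !trmx0 trmx1.
  rewrite !(mulmx0, mul0mx, addr0, add0r, mulmx1, mul1mx); congr block_mx.
  by apply/matrixP => i j; rewrite !mxE !ord1.
by rewrite /M !mulmxA PTP mul1mx -mulmxA QTQ mulmx1.
Qed.

End SVD.

(** * The tangent inequality for real powers *)

Section PowR.
Variable R : realType.

Lemma powR_tangent_lt (p s : R) : 1 < p -> 0 <= s -> s != 1 ->
  p * s < s `^ p + (p - 1).
Proof.
(* s^p = s * s^(p-1); bound s^(p-1) and 1/s below by the tangent of exp at 0 *)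
move=> p1; rewrite le0r => /orP[/eqP-> _|s0 s1].
  by rewrite powR0 ?mulr0 ?add0r ?subr_gt0// gt_eqF// (lt_trans _ p1).
have m0 : ln s != 0 by rewrite ln_eq0.
have sE : expR (ln s) = s by rewrite lnK.
have -> : s `^ p = s * expR ((p - 1) * ln s).
  by rewrite /powR gt_eqF// -[X in X * expR _]sE -expRD; congr expR; ring.
have h1 : 1 + (p - 1) * ln s < expR ((p - 1) * ln s).
  by apply: expR_gt1Dx; rewrite mulf_neq0// subr_eq0 gt_eqF.
have h2 : s * (1 - ln s) <= 1.
  rewrite -[X in _ <= X](mulfV (lt0r_neq0 s0)) ler_pM2l//.
  by rewrite -[s in s^-1]sE -expRN; exact: expR_ge1Dx.
move: h1; rewrite -(ltr_pM2l s0) => h1.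
have p10 : 0 <= p - 1 by rewrite subr_ge0 ltW.
have := ler_wpM2l p10 h2; nra.
Qed.

Lemma powR_tangent_le (p s : R) : 1 < p -> 0 <= s ->
  p * s <= s `^ p + (p - 1).
Proof.
move=> p1 s0; have [->|s1] := eqVneq s 1; last exact/ltW/powR_tangent_lt.
by rewrite powR1; lra.
Qed.

Lemma ler_powR_pos (q a b : R) : 0 < q -> 0 <= a -> 0 <= b ->
  (a `^ q <= b `^ q) = (a <= b).
Proof.
move=> q0 a0 b0; apply/idP/idP => [|ab]; last by rewrite ge0_ler_powR// ltW.
by apply: contraTT; rewrite -!ltNge => ba; rewrite gt0_ltr_powR.
Qed.

End PowR.

(** * Trace duality and its equality case *)

Section Trace.
Variable R : realType.

Lemma tr_mul_diag_mx n (s : 'rV[R]_n) (M : 'M[R]_n) :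
  \tr (diag_mx s *m M) = \sum_i s 0 i * M i i.
Proof. by apply: eq_bigr => i _; rewrite mul_diag_mx mxE. Qed.

Lemma mulmx_trmx_diagE m n (G : 'M[R]_(m, n)) i :
  (G^T *m G) i i = \sum_k G k i ^+ 2.
Proof. by rewrite mxE; apply: eq_bigr => k _; rewrite mxE expr2. Qed.

Lemma mulmx_trmx_diag_ge0 m n (G : 'M[R]_(m, n)) i : 0 <= (G^T *m G) i i.
Proof. by rewrite mulmx_trmx_diagE; apply: sumr_ge0 => k _; exact: sqr_ge0. Qed.

Lemma mxtrace_trmx_mul_eq0 m n (G : 'M[R]_(m, n)) : \tr (G^T *m G) = 0 -> G = 0.
Proof.
move=> /eqP; rewrite psumr_eq0 => [/allP G0|i _]; last exact: mulmx_trmx_diag_ge0.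
apply/matrixP => k i; rewrite mxE; apply/eqP; rewrite -sqrf_eq0.
have := G0 i (mem_index_enum i); rewrite mulmx_trmx_diagE psumr_eq0 => [/allP|j _].
  by move=> /(_ k (mem_index_enum k)).
exact: sqr_ge0.
Qed.

(** AM-GM on each term of the inner product of two columns. This additive form can be both bounded
    entry by entry and summed into traces. *)
Lemma mulmx_trmx_diag_young m n (F G : 'M[R]_(m, n)) i :
  `|(F^T *m G) i i| <= ((F^T *m F) i i + (G^T *m G) i i) / 2.
Proof.
rewrite mxE !mulmx_trmx_diagE -big_split /= mulr_suml.
apply: (le_trans (ler_norm_sum _ _ _)); apply: ler_sum => k _; rewrite mxE.
rewrite normrM -[X in _ <= (X + _) / _]real_normK ?num_real//.
rewrite -[X in _ <= (_ + X) / _]real_normK ?num_real//.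
have := sqr_ge0 (`|F k i| - `|G k i|); lra.
Qed.

(* Pointwise, s^p + (p-1)|d| - p s d is a sum of three nonnegative terms. *)
Lemma schatten_gap (p s d : R) : 1 < p -> 0 <= s -> `|d| <= 1 ->
  p * (s * d) <= s `^ p + (p - 1) * `|d|
  /\ (s `^ p + (p - 1) * `|d| <= p * (s * d) -> s = d /\ s `^ p = s * d).
Proof.
move=> p1 s0 d1.
have p0 : 0 < p by exact: lt_trans p1.
have t1 : 0 <= s `^ p * (1 - `|d|) by rewrite mulr_ge0 ?powR_ge0// subr_ge0.
have t2 : 0 <= `|d| * (s `^ p + (p - 1) - p * s).
  by rewrite mulr_ge0// subr_ge0 powR_tangent_le.
have t3 : 0 <= p * s * (`|d| - d).
  by rewrite !mulr_ge0 ?subr_ge0 ?ler_norm// ltW.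
have gapE : s `^ p + (p - 1) * `|d| - p * (s * d) =
  s `^ p * (1 - `|d|) + `|d| * (s `^ p + (p - 1) - p * s) + p * s * (`|d| - d) by ring.
split; first by rewrite -subr_ge0 gapE !addr_ge0.
move=> gap; have {}gap : s `^ p * (1 - `|d|) + `|d| * (s `^ p + (p - 1) - p * s)
   + p * s * (`|d| - d) <= 0 by rewrite -gapE subr_le0.
have e1 : s `^ p * (1 - `|d|) = 0 by lra.
have e2 : `|d| * (s `^ p + (p - 1) - p * s) = 0 by lra.
have e3 : p * s * (`|d| - d) = 0 by lra.
(* All three terms vanish. If [d = 0], the first gives [s = 0]. Otherwise strictness in the second
   gives [s = 1], then the first gives [|d| = 1] and the third [d = |d|]. *)
have [d0|dN0] := eqVneq d 0.
  move: e1; rewrite d0 normr0 subr0 mulr1 => /powR_eq0_eq0 ->.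
  by rewrite powR0 ?mulr0// gt_eqF.
have s1 : s = 1.
  apply/eqP; apply: contraTT (lexx (0 : R)) => sN1; rewrite -ltNge -[X in _ < X]e2.
  by rewrite mulr_gt0 ?normr_gt0// subr_gt0 powR_tangent_lt.
move: e1 e3; rewrite s1 powR1 !mul1r mulr1 => /eqP; rewrite subr_eq0 => /eqP <-.
by move/eqP; rewrite mulf_eq0 gt_eqF//= subr_eq0 => /eqP <-.
Qed.

(* Hölder's inequality against Y, in tangent form, with its equality case. *)
Lemma schatten_tangent n (p r : R) (X Y U V : 'M[R]_n) (s : 'rV[R]_n) :
  1 < p -> (forall i, 0 <= s 0 i) -> U *m U^T = 1%:M -> V *m V^T = 1%:M ->
  X = U *m diag_mx s *m V^T ->
  (forall i, `|(U^T *m Y *m V) i i| <= 1) ->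
  \sum_i `|(U^T *m Y *m V) i i| <= r ->
  p * \tr (X^T *m Y) <= \sum_i s 0 i `^ p + (p - 1) * r /\
  (\sum_i s 0 i `^ p <= r -> r <= \tr (X^T *m Y) -> \tr (Y^T *m Y) = r -> X = Y).
Proof.
move=> p1 s0 UU VV XE; set d := fun i => (U^T *m Y *m V) i i => d1 dr.
have UTU := mulmx1C UU; have VTV := mulmx1C VV.
have XYE : \tr (X^T *m Y) = \sum_i s 0 i * d i.
  rewrite -tr_mul_diag_mx XE !trmx_mul trmxK tr_diag_mx -!mulmxA mxtrace_mulC.
  by rewrite !mulmxA.
have XXE : \tr (X^T *m X) = \sum_i s 0 i * s 0 i.
  rewrite {2}XE XE !trmx_mul trmxK tr_diag_mx -!mulmxA mxtrace_mulC -!mulmxA VTV.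
  rewrite mulmx1 (mulmxA U^T) UTU mul1mx tr_mul_diag_mx.
  by apply: eq_bigr => i _; rewrite mxE eqxx mulr1n.
have gap i := schatten_gap p1 (s0 i) (d1 i).
have p10 : 0 <= p - 1 by rewrite subr_ge0 ltW.
have le1 : p * \tr (X^T *m Y) <= \sum_i (s 0 i `^ p + (p - 1) * `|d i|).
  by rewrite XYE mulr_sumr; apply: ler_sum => i _; case: (gap i).
have le2 : \sum_i (s 0 i `^ p + (p - 1) * `|d i|) <= \sum_i s 0 i `^ p + (p - 1) * r.
  by rewrite big_split /= -mulr_sumr lerD2l ler_wpM2l.
split=> [|spr rXY YYE]; first exact: le_trans le2.
(* The gaps are nonnegative and sum to at most [r + (p - 1) r - p r = 0], so each one is zero. *)
have /eqP : \sum_i (s 0 i `^ p + (p - 1) * `|d i| - p * (s 0 i * d i)) = 0.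
  apply/eqP; rewrite eq_le sumr_ge0 => [|i _]; last by rewrite subr_ge0; case: (gap i).
  rewrite andbT sumrB -mulr_sumr -XYE.
  have := ler_wpM2l (ltW (lt_trans ltr01 p1)) rXY; lra.
rewrite psumr_eq0 => [/allP e|i _]; last by rewrite subr_ge0; case: (gap i).
have sd i : s 0 i = d i /\ s 0 i `^ p = s 0 i * d i.
  apply: (gap i).2.
  by have := e i (mem_index_enum i); rewrite subr_eq0 => /eqP ->.
(* The traces of [X^T X], [X^T Y] and [Y^T Y] all agree, so the Frobenius norm of [X - Y] is
   zero. *)
have XX : \tr (X^T *m X) = \tr (X^T *m Y).
  by rewrite XXE XYE; apply: eq_bigr => i _; rewrite {2}(sd i).1.
have XYr : \tr (X^T *m Y) = r.
  apply/eqP; rewrite eq_le rXY andbT (le_trans _ spr)// XYE.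
  by apply: ler_sum => i _; rewrite (sd i).2.
have YX : \tr (Y^T *m X) = \tr (X^T *m Y) by rewrite -mxtrace_tr trmx_mul trmxK.
apply/eqP; rewrite -subr_eq0; apply/eqP/mxtrace_trmx_mul_eq0.
by rewrite [(X - Y)^T]linearB mulmxBl !mulmxBr !linearB /= YX XX YYE XYr; ring.
Qed.

End Trace.

(** * The projection [1 - J] and permutation matrices *)

Section Centering.
Variables (R : realType) (n : nat).
Local Notation J := (Jmat R n).

Lemma trmx_Jmat : J^T = J.
Proof. by apply/matrixP => i j; rewrite !mxE. Qed.

Lemma mul_Jmat_r (B : 'M[R]_n) : (forall i, \sum_j B i j = 1) -> B *m J = J.
Proof.
move=> B1; apply/matrixP => i j; rewrite !mxE.
by under eq_bigr do rewrite mxE; rewrite -mulr_suml B1 mul1r.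
Qed.

Lemma mul_Jmat_l (B : 'M[R]_n) : (forall j, \sum_i B i j = 1) -> J *m B = J.
Proof.
move=> B1; apply/matrixP => i j; rewrite !mxE.
by under eq_bigr do rewrite mxE; rewrite -mulr_sumr B1 mulr1.
Qed.

Lemma doubly_stochastic_perm_mx (s : 'S_n) : doubly_stochastic (perm_mx s : 'M[R]_n).
Proof.
split; first by move=> i j; rewrite !mxE ler0n.
split=> i.
  rewrite (bigD1 (s i)) //= !mxE eqxx big1 ?addr0// => j /negPf js.
  by rewrite !mxE eq_sym js.
rewrite (bigD1 (s^-1%g i)) //= !mxE permKV eqxx big1 ?addr0// => j js.
by rewrite !mxE -(inj_eq (@perm_inj _ s^-1%g)) permK (negPf js).
Qed.

Hypothesis n_gt0 : (0 < n)%N.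

Lemma sum_Jmat (i : 'I_n) : \sum_(j < n) J i j = 1.
Proof.
under eq_bigr do rewrite mxE.
by rewrite sumr_const card_ord -[LHS]mulr_natr mulVf// pnatr_eq0 -lt0n.
Qed.

Lemma Jmat_idem : J *m J = J.
Proof. exact/mul_Jmat_r/sum_Jmat. Qed.

Lemma mxtrace_Jmat : \tr J = 1.
Proof.
rewrite -(sum_Jmat (Ordinal n_gt0)); apply: eq_bigr => i _.
by rewrite !mxE.
Qed.

Local Notation Pi := (1%:M - J).

Lemma trmx_Pi : Pi^T = Pi.
Proof. by rewrite linearB /= trmx1 trmx_Jmat. Qed.

Lemma Pi_idem : Pi *m Pi = Pi.
Proof. by rewrite mulmxBl mul1mx mulmxBr mulmx1 Jmat_idem subrr subr0. Qed.

Lemma mulmx_trmx_Pi (W : 'M[R]_n) : (Pi *m W)^T *m (Pi *m W) = W^T *m Pi *m W.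
Proof. by rewrite trmx_mul trmx_Pi -[LHS]mulmxA (mulmxA Pi) Pi_idem mulmxA. Qed.

(** The matrix is [1 - (J W)^T (J W)], and the subtracted term has a nonnegative diagonal. *)
Lemma Pi_diag_le1 (W : 'M[R]_n) i : W *m W^T = 1%:M ->
  ((Pi *m W)^T *m (Pi *m W)) i i <= 1.
Proof.
move=> /mulmx1C WW; rewrite mulmx_trmx_Pi mulmxBr mulmx1 mulmxBl WW.
have -> : W^T *m J *m W = (J *m W)^T *m (J *m W).
  by rewrite trmx_mul trmx_Jmat -[RHS]mulmxA (mulmxA J) Jmat_idem mulmxA.
have := mulmx_trmx_diag_ge0 (J *m W) i.
by move: (_ *m _) => Z; rewrite !mxE eqxx => ?; rewrite gerBl.
Qed.

Lemma mxtrace_Pi (W : 'M[R]_n) : W *m W^T = 1%:M ->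
  \tr ((Pi *m W)^T *m (Pi *m W)) = n%:R - 1.
Proof.
move=> WW; rewrite mulmx_trmx_Pi mxtrace_mulC mulmxA WW mul1mx.
by rewrite linearB /= mxtrace1 mxtrace_Jmat.
Qed.

(** Supplies the hypotheses of [schatten_tangent] for [Y = J - P] and [r = n - 1]. With the
    orthogonal [W = P^T U], the matrix is [- (Pi W)^T (Pi V)]; each diagonal entry is thus dominated
    by the mean of two entries that are at most 1 and have trace [n - 1]. *)
Lemma perm_diag_bounds (s : 'S_n) (U V : 'M[R]_n) :
  U *m U^T = 1%:M -> V *m V^T = 1%:M ->
  let d i := (U^T *m (J - perm_mx s) *m V) i i in
  (forall i, `|d i| <= 1) /\ \sum_i `|d i| <= n%:R - 1.
Proof.
move=> UU VV /=; set P := perm_mx s.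
have [_ [P1 _]] := doubly_stochastic_perm_mx s.
pose W := P^T *m U.
have WW : W *m W^T = 1%:M.
  rewrite trmx_mul trmxK mulmxA -(mulmxA P^T) UU mulmx1.
  by rewrite /P tr_perm_mx -perm_mxM mulVg perm_mx1.
have dE : U^T *m (J - P) *m V = - ((Pi *m W)^T *m (Pi *m V)).
  have PPi : P *m Pi = P - J by rewrite mulmxBr mulmx1 (mul_Jmat_r P1).
  rewrite [(Pi *m W)^T]trmx_mul trmx_Pi -[W^T *m _ *m _]mulmxA (mulmxA Pi) Pi_idem.
  rewrite trmx_mul trmxK -[U^T *m P *m _]mulmxA (mulmxA P) PPi -mulmxN -mulNmx opprB.
  by rewrite mulmxA.
have db i : `|(U^T *m (J - P) *m V) i i| <=
    (((Pi *m W)^T *m (Pi *m W)) i i + ((Pi *m V)^T *m (Pi *m V)) i i) / 2.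
  by rewrite dE mxE normrN mulmx_trmx_diag_young.
split=> [i|].
  by apply: le_trans (db i) _; have := Pi_diag_le1 i WW; have := Pi_diag_le1 i VV; lra.
apply: le_trans (ler_sum _ (fun i _ => db i)) _.
rewrite -mulr_suml big_split /= -/(\tr _) -/(\tr (_ *m (Pi *m V))) !mxtrace_Pi//; lra.
Qed.

(** Here [P^T (J - P) = J - 1], whose trace is [1 - n]. *)
Lemma mxtrace_perm_diff (A : 'M[R]_n) (s : 'S_n) :
  \tr ((A - perm_mx s)^T *m (J - perm_mx s)) =
  \tr (A^T *m (J - perm_mx s)) + (n%:R - 1).
Proof.
rewrite [(A - _)^T]linearB mulmxBl [\tr (_ - _)]linearB; congr (_ + _).
rewrite /= mulmxBr tr_perm_mx -perm_mxM mulVg perm_mx1 [\tr _]linearB /= mxtrace1 opprB.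
rewrite mul_Jmat_r ?mxtrace_Jmat//.
by have [_ []] := doubly_stochastic_perm_mx (s^-1%g).
Qed.

End Centering.

(* The cyclic shifts average to J, so A cannot correlate with all of them
   more than with J. *)
Lemma exists_perm_trace_ge (R : realType) (n : nat) (A : 'M[R]_n) : (0 < n)%N ->
  exists s : 'S_n, 0 <= \tr (A^T *m (Jmat R n - perm_mx s)).
Proof.
case: n A => // n A _.
(* The cyclic shift [i -> i + k] modulo [n + 1]. *)
pose c (k : 'I_n.+1) := perm (addIr k).
suff [k ck] : exists k, 0 <= \tr (A^T *m (Jmat R n.+1 - perm_mx (c k))) by exists (c k).
apply/existsP; apply: contraT; rewrite negb_exists => /forallP neg.
suff : \sum_k \tr (A^T *m (Jmat R n.+1 - perm_mx (c k))) = 0.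
  move/eqP; rewrite big_ord_recl => h.
  have : \tr (A^T *m (Jmat R n.+1 - perm_mx (c ord0))) < 0 by rewrite ltNge neg.
  have : \sum_(i < n) \tr (A^T *m (Jmat R n.+1 - perm_mx (c (lift ord0 i)))) <= 0.
    by apply: sumr_le0 => i _; rewrite ltW// ltNge neg.
  move: h => /eqP; lra.
rewrite -linear_sum -mulmx_sumr.
suff -> : \sum_k (Jmat R n.+1 - perm_mx (c k)) = 0 by rewrite mulmx0 linear0.
apply/matrixP => i j; rewrite summxE mxE.
under eq_bigr do rewrite !mxE permE.
rewrite sumrB sumr_const card_ord -[X in X - _]mulr_natr mulVf ?pnatr_eq0//.
(* Only the shift by [k = j - i] sends [i] to [j], so the shifts add up to the all-ones matrix. *)
rewrite (bigD1 (j - i)) //= [i + (j - i)]addrC subrK eqxx big1 ?addr0 ?subrr// => k kji.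
have -> : (i + k == j) = false; last by [].
by apply: contraNF kji => /eqP <-; rewrite [i + k]addrC addrK.
Qed.

(** * Upper bound on the distance from [J] *)

Section Contraction.
Variables (R : realType) (n : nat).

(** The difference of the two sides is the variance of [v] under the weights [b]. *)
Lemma sqr_sum_convex (b v : 'I_n -> R) : (forall j, 0 <= b j) ->
  \sum_j b j = 1 -> (\sum_j b j * v j) ^+ 2 <= \sum_j b j * v j ^+ 2.
Proof.
move=> b0 b1; have [m mE] : exists m, m = \sum_j b j * v j by eexists.
rewrite -mE.
have : 0 <= \sum_j b j * (v j - m) ^+ 2.
  by apply: sumr_ge0 => j _; rewrite mulr_ge0// sqr_ge0.
suff -> : \sum_j b j * (v j - m) ^+ 2 = \sum_j b j * v j ^+ 2 - m ^+ 2.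
  by rewrite subr_ge0.
have -> : m ^+ 2 = 2 * m * (\sum_j b j * v j) - m ^+ 2 * \sum_j b j.
  by rewrite -mE b1; ring.
rewrite !mulr_sumr -!sumrB; apply: eq_bigr => j _; ring.
Qed.

(** Convexity of the square along the rows of [B], then the column sums after exchanging the order
    of summation. *)
Lemma doubly_stochastic_contraction (B G : 'M[R]_n) i : doubly_stochastic B ->
  ((B *m G)^T *m (B *m G)) i i <= (G^T *m G) i i.
Proof.
move=> [B0 [B1 B2]]; rewrite !mulmx_trmx_diagE.
apply: (@le_trans _ _ (\sum_k \sum_j B k j * G j i ^+ 2)).
  by apply: ler_sum => k _; rewrite mxE sqr_sum_convex.
rewrite exchange_big /= le_eqVlt; apply/orP; left; apply/eqP.
by apply: eq_bigr => j _; rewrite -mulr_suml B2 mul1r.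
Qed.

Lemma sum_singular_Jmat_sub (p : R) (B : 'M[R]_n) (s : 'rV[R]_n) : (0 < n)%N ->
  1 < p -> doubly_stochastic B -> is_singular_values (Jmat R n - B) s ->
  \sum_i s 0 i `^ p <= n%:R - 1.
Proof.
move=> n0 p1 dB [s0 [U [V [UU [VV XE]]]]].
have [B0 [B1 B2]] := dB.
have p0 : 0 < p by exact: lt_trans p1.
have UTU := mulmx1C UU; have VTV := mulmx1C VV.
have XV : (Jmat R n - B) *m V = - (B *m ((1%:M - Jmat R n) *m V)).
  by rewrite mulmxA mulmxBr mulmx1 mul_Jmat_r// -mulNmx opprB.
have s1 i : s 0 i <= 1.
  rewrite -(@ler_pXn2r _ 2)// ?nnegrE ?s0//; rewrite expr1n.
  apply: le_trans (Pi_diag_le1 n0 i VV).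
  apply: le_trans (doubly_stochastic_contraction _ i dB).
  have -> : (B *m ((1%:M - Jmat R n) *m V))^T *m (B *m ((1%:M - Jmat R n) *m V))
     = diag_mx s *m diag_mx s.
    rewrite -[LHS]opprK -mulmxN -mulNmx -linearN /= -XV XE -!mulmxA VTV mulmx1.
    by rewrite trmx_mul tr_diag_mx -mulmxA (mulmxA U^T) UTU mul1mx.
  by rewrite mul_diag_mx !mxE eqxx mulr1n expr2.
(* The all-ones row is in the left kernel, since [J] and [B] have the same column sums. *)
have : \det (Jmat R n - B) == 0.
  apply/det0P; exists (const_mx 1).
    by apply/eqP => /rowP/(_ (Ordinal n0))/eqP; rewrite !mxE oner_eq0.
  apply/rowP => j; transitivity (\sum_(i < n) (n%:R^-1 - B i j)).
    by rewrite mxE; apply: eq_bigr => i _; rewrite !mxE mul1r.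
  rewrite sumrB B2 sumr_const card_ord -[X in X - _]mulr_natr mulVf.
    by rewrite subrr mxE.
  by rewrite pnatr_eq0 -lt0n.
have /mulmx1_unit[] := UU; rewrite !unitmxE !unitfE => detU _.
have /mulmx1_unit[] := VV; rewrite !unitmxE !unitfE => _ detV.
rewrite XE !det_mulmx !mulf_eq0 (negPf detU) (negPf detV) orbF /= det_diag.
(* Some singular value is zero and contributes nothing; the other [n - 1] contribute at most 1
   each. *)
move=> /prodf_eq0[i _ /eqP si0].
rewrite (bigD1 i) //= si0 powR0 ?gt_eqF// add0r.
apply: (@le_trans _ _ (\sum_(j < n | j != i) 1)).
  apply: ler_sum => j _.
  have -> : 1 = 1 `^ p :> R by rewrite powR1.
  by rewrite ler_powR_pos.
by rewrite sumr_const cardC1 card_ord -subn1 natrB.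
Qed.

End Contraction.

(** * The Chebyshev radius and the unique center *)

Section Radius.
Variables (R : realType) (n : nat) (p : R).
Hypotheses (n_gt0 : (0 < n)%N) (p_gt1 : 1 < p).

Let n1_ge0 : 0 <= n%:R - 1 :> R.
Proof. by rewrite subr_ge0 ler1n. Qed.

Let pV_gt0 : 0 < p^-1.
Proof. by rewrite invr_gt0 (lt_trans _ p_gt1). Qed.

(** The default value 0 is never reached, because every matrix has a singular value
    decomposition. *)
Lemma singular_valuesP (A : 'M[R]_n) : is_singular_values A (singular_values A).
Proof.
rewrite /singular_values; case: pselect => [h|[]]; first by case: cid.
have [s0 [U [V [? ?]]]] := exists_svd A.
by exists s0; split=> //; exists U, V.
Qed.

Lemma schatten_le (A : 'M[R]_n) : (schatten p A <= (n%:R - 1) `^ p^-1) =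
  (\sum_i singular_values A 0 i `^ p <= n%:R - 1).
Proof. by rewrite ler_powR_pos// sumr_ge0// => i _; exact: powR_ge0. Qed.

Lemma schatten_ge (A : 'M[R]_n) : ((n%:R - 1) `^ p^-1 <= schatten p A) =
  (n%:R - 1 <= \sum_i singular_values A 0 i `^ p).
Proof. by rewrite ler_powR_pos// sumr_ge0// => i _; exact: powR_ge0. Qed.

(** One permutation gives both the lower bound and uniqueness, through [schatten_tangent] with
    [X = A - P], [Y = J - P] and [r = n - 1]. *)
Lemma exists_far_perm (A : 'M[R]_n) : exists s : 'S_n,
  (n%:R - 1) `^ p^-1 <= schatten p (A - perm_mx s) /\
  (schatten p (A - perm_mx s) <= (n%:R - 1) `^ p^-1 -> A = Jmat R n).
Proof.
have [s tr_ge] := exists_perm_trace_ge A n_gt0; exists s.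
have [sv0 [U [V [UU [VV XE]]]]] := singular_valuesP (A - perm_mx s).
have [d1 dr] := perm_diag_bounds n_gt0 s UU VV.
have [le_sum eq_case] := schatten_tangent p_gt1 sv0 UU VV XE d1 dr.
have tr_ge' : n%:R - 1 <= \tr ((A - perm_mx s)^T *m (Jmat R n - perm_mx s)).
  by rewrite mxtrace_perm_diff// lerDr.
split=> [|].
  rewrite schatten_ge.
  have := ler_wpM2l (ltW (lt_trans ltr01 p_gt1)) tr_ge'; lra.
rewrite schatten_le => le_n1.
(* The trace formula is reused with [A = J], where [J (J - P) = 0]. *)
have YY : \tr ((Jmat R n - perm_mx s)^T *m (Jmat R n - perm_mx s)) = n%:R - 1.
  have [_ [_ P2]] := doubly_stochastic_perm_mx R s.
  rewrite mxtrace_perm_diff// trmx_Jmat mulmxBr Jmat_idem// mul_Jmat_l//.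
  by rewrite subrr linear0 add0r.
exact: addIr (eq_case le_n1 tr_ge' YY).
Qed.

Lemma cheb_sup_ge (A : 'M[R]_n) : (((n%:R - 1) `^ p^-1)%:E <= cheb_sup p A)%E.
Proof.
have [s [ge_s _]] := exists_far_perm A.
apply: (@le_trans _ _ (schatten p (A - perm_mx s))%:E); first by rewrite lee_fin.
apply: ereal_sup_ubound; exists (perm_mx s) => //.
exact: doubly_stochastic_perm_mx.
Qed.

Lemma cheb_sup_le_eq (A : 'M[R]_n) :
  (cheb_sup p A <= ((n%:R - 1) `^ p^-1)%:E)%E -> A = Jmat R n.
Proof.
have [s [_ eq_s]] := exists_far_perm A.
move=> le_A; apply: eq_s; rewrite -lee_fin; apply: le_trans le_A.
apply: ereal_sup_ubound; exists (perm_mx s) => //.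
exact: doubly_stochastic_perm_mx.
Qed.

Lemma cheb_sup_Jmat : cheb_sup p (Jmat R n) = ((n%:R - 1) `^ p^-1)%:E.
Proof.
apply/eqP; rewrite eq_le cheb_sup_ge andbT.
apply: ge_ereal_sup => _ [B dB <-]; rewrite lee_fin schatten_le.
exact: sum_singular_Jmat_sub dB (singular_valuesP _).
Qed.

Lemma cheb_radiusE : cheb_radius n p = ((n%:R - 1) `^ p^-1)%:E.
Proof.
apply/eqP; rewrite eq_le; apply/andP; split.
  by rewrite -cheb_sup_Jmat; apply: ereal_inf_lbound; exists (Jmat R n).
by apply: le_ereal_inf_tmp => _ [A _ <-]; exact: cheb_sup_ge.
Qed.

End Radius.

Theorem mainTheorem6 (R : realType) (n : nat) (p : R) :
  (0 < n)%N -> 1 < p ->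
  cheb_radius n p = (((n%:R - 1) `^ p^-1)%:E)%E /\
  (forall A : 'M[R]_n, cheb_sup p A = cheb_radius n p <-> A = Jmat R n).
Proof.
move=> n_gt0 p_gt1; rewrite cheb_radiusE//; split=> // A; split=> [eqA|->].
  by apply: (cheb_sup_le_eq n_gt0 p_gt1); rewrite eqA.
exact: cheb_sup_Jmat.
Qed.
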